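(* Let $k$ be a field, $R$ a standard graded $k$-algebra, and let $a,b\in R_1$ form an exact pair of zero divisors on $R$. Then for every finitely generated positively graded $R/aR$-module $M$, $$P^R_M(s,t)=P^{R/aR}_M(s,t)\cdot\frac{1}{1-st}.$$
   Context: A standard graded $k$-algebra is a commutative graded ring $R=\bigoplus_{n\ge0}R_n$ with $R_0=k$, finitely generated as a $k$-algebra by $R_1$. Elements $a,b\in R$ form an exact pair of zero divisors if $a,b$ are nonzero non-units with $(0:_R a)=bR$ and $(0:_R b)=aR$. For a finitely generated graded module $M$ over a standard graded $k$-algebra $S$, $\operatorname{Tor}^S_i(M,k)$ inherits a grading from a graded free resolution; set $\beta^S_{i,j}(M)=\operatorname{rank}_k\operatorname{Tor}^S_i(M,k)_j$ and define the graded Poincaré series $P^S_M(s,t)=\sum_{i,j}\beta^S_{i,j}(M)s^it^j\in\mathbb Z[s^{\pm1}][[t]]$. *)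

(* Defs.v *)
From HB Require Import structures.
From mathcomp Require Import all_boot all_order all_algebra.
From mathcomp Require Import mpoly.
Import Order.TTheory GRing.Theory Num.Theory.
Local Open Scope ring_scope.

(* Polynomial ring k[x_0..x_{n-1}] over a field k; a standard graded k-algebra
   is presented as k[x]/<gs> with gs a finite list of homogeneous polynomials. *)
Notation Poly k n := {mpoly k[n]}.

Definition in_ideal {k : fieldType} {n : nat} (gs : seq (Poly k n)) (f : Poly k n) : Prop :=
  exists c : 'I_(size gs) -> Poly k n, f = \sum_(i < size gs) c i * gs`_i.

Definition in_image {k : fieldType} {n : nat} (gs : seq (Poly k n)) {r m : nat}
  (A : 'M[Poly k n]_(r, m)) (v : 'cV[Poly k n]_r) : Prop :=
  exists w : 'cV[Poly k n]_m, forall p : 'I_r, in_ideal gs ((v - A *m w) p 0).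

(* Graded free module F_i = (+)_p S(-(d i)_p), S = k[x]/<gs>; the differential
   F_{i+1} -> F_i is the matrix phi i (entries are homogeneous representatives).
   is_min_graded_res gs d phi : (d, phi) is a minimal graded free resolution over
   S = k[x]/<gs> of the module coker(phi 0). *)
Definition is_min_graded_res {k : fieldType} {n : nat} (gs : seq (Poly k n))
  (d : nat -> seq int)
  (phi : forall i : nat, 'M[Poly k n]_(size (d i), size (d i.+1))) : Prop :=
  [/\
      forall i (p : 'I_(size (d i))) (q : 'I_(size (d i.+1))),
        let e := (d i.+1)`_q - (d i)`_p in
        (e < 0 -> phi i p q = 0) /\ (0 <= e -> phi i p q \is (`|e|%N).-homog),
      forall i (p : 'I_(size (d i))) (q : 'I_(size (d i.+1))),
        (phi i p q)@_0%MM = 0,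
      forall i (p : 'I_(size (d i))) (q : 'I_(size (d i.+2))),
        in_ideal gs ((phi i *m phi i.+1) p q)
    &
      forall i (v : 'cV[Poly k n]_(size (d i.+1))),
        (forall p, in_ideal gs ((phi i *m v) p 0)) -> in_image gs (phi i.+1) v].

Definition betti (d : nat -> seq int) (i : nat) (j : int) : nat :=
  count (pred1 j) (d i).

(* coker A over k[x]/<gs>, viewed as a module over k[x]/<gs>, equals
   coker [B | a*Id] over k[x]/<gs>:  im A + <gs>F_0 = im B + aF_0 + <gs>F_0 *)
Definition same_presentation {k : fieldType} {n : nat} (gs : seq (Poly k n))
  (a : Poly k n) {r m1 m2 : nat} (A : 'M[Poly k n]_(r, m1)) (B : 'M[Poly k n]_(r, m2)) : Prop :=
  (forall q, in_image gs (row_mx B (a%:M)) (col q A)) /\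
  (forall q, in_image gs A (col q (row_mx B (a%:M)))).

Definition exact_zero_divisor_pair {k : fieldType} {n : nat} (gs : seq (Poly k n))
  (a b : Poly k n) : Prop :=
  (~ in_ideal gs a /\ ~ in_ideal gs b) /\
  (~ (exists u, in_ideal gs (a * u - 1)) /\ ~ (exists u, in_ideal gs (b * u - 1))) /\
  (forall f, in_ideal gs (f * a) <-> in_ideal (b :: gs) f) /\
  (forall f, in_ideal gs (f * b) <-> in_ideal (a :: gs) f).

(* Main.v *)
Require Import Defs.
From HB Require Import structures.
From mathcomp Require Import all_boot all_order all_algebra.
From mathcomp Require Import mpoly.
From mathcomp Require Import zify.
From Stdlib Require Import ClassicalEpsilon.
Import Order.TTheory GRing.Theory Num.Theory.
Local Open Scope ring_scope.

(** Write S = R/a and let M be presented over S by a minimal matrix A from F_1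
to F_0, with first syzygy N = im A.  If G is the minimal R-resolution of N
and T is the resolution ... -b-> R(-1) -a-> R of S tensored with F_0, then M is
resolved over R by the mapping cone of a comparison map h from G to T.  This map
is obtained step by step by dividing a product of two minimal matrices by the
linear form a or b; such a product has entries of degree at least 2, so h can
be taken minimal and the cone is minimal.  Hence P^R_M = F_0(t)/(1 - st) + s P^R_N,
while P^S_M = F_0(t) + s P^S_N, and the formula follows by induction on the
truncation.  Minimal resolutions of one module have the same Betti numbers, since
comparison maps between them are inverse to each other modulo the irrelevant ideal. *)

Set Implicit Arguments.
Unset Strict Implicit.
Unset Printing Implicit Defensive.

(* [comp e] is the projection onto the homogeneous component of degree [e] and
   [aug] the reduction modulo the irrelevant ideal. *)
Record grading (k : fieldType) (R : comNzRingType) := Grading {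
  comp : int -> {additive R -> R};
  aug : {rmorphism R -> k};
  comp_id : forall e x, comp e (comp e x) = comp e x;
  compM : forall e f x y, comp (e + f) (comp e x * y) = comp e x * comp f y;
  comp01 : comp 0 1 = 1;
  comp_lt0 : forall e x, e < 0 -> comp e x = 0;
  comp0_aug : forall x, aug x = 0 -> comp 0 x = 0;
  aug_comp : forall e x, e != 0 -> aug (comp e x) = 0 }.

(** * Homogeneous matrices over a graded ring *)

Section Graded.

Context {k : fieldType} {R : comNzRingType} (G : grading k R).

Definition hom {r0 r1} (d0 : 'I_r0 -> int) (d1 : 'I_r1 -> int) (A : 'M[R]_(r0, r1)) :=
  forall p q, comp G (d1 q - d0 p) (A p q) = A p q.

Definition minhom {r0 r1} (d0 : 'I_r0 -> int) (d1 : 'I_r1 -> int) (A : 'M[R]_(r0, r1)) :=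
  hom d0 d1 A /\ forall p q, aug G (A p q) = 0.

(** Testing with matrices [V] rather than vectors lets a whole map be lifted at once. *)
Definition exact_mx {r0 r1 r2} (A : 'M[R]_(r0, r1)) (B : 'M[R]_(r1, r2)) :=
  forall m (V : 'M_(r1, m)), A *m V = 0 -> exists W, V = B *m W.

Definition im_le {r m1 m2} (A : 'M[R]_(r, m1)) (B : 'M[R]_(r, m2)) :=
  exists W, A = B *m W.

Definition dim {r} (d : 'I_r -> int) (j : int) : nat := #|[pred p | d p == j]|.

Definition dcat {r1 r2} (d1 : 'I_r1 -> int) (d2 : 'I_r2 -> int) (p : 'I_(r1 + r2)) :=
  match split p with inl i => d1 i | inr i => d2 i end.

Definition dshift {r} (d : 'I_r -> int) (c : int) : 'I_r -> int := fun p => d p + c.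

(* [A] is the first matrix of a complex of [N + 1] minimal matrices that is
   exact in positive degrees; [beta l] counts the degrees in the source of the
   [l]-th matrix. *)
Fixpoint minres N r0 (d0 : 'I_r0 -> int) r1 (d1 : 'I_r1 -> int) (A : 'M[R]_(r0, r1))
    (beta : nat -> int -> nat) : Prop :=
  [/\ minhom d0 d1 A, beta 0%N =1 dim d1 &
      if N is N'.+1 then
        exists r2 (d2 : 'I_r2 -> int) (B : 'M[R]_(r1, r2)),
          [/\ A *m B = 0, exact_mx A B & minres N' d1 d2 B (fun l => beta l.+1)]
      else True].

Lemma minres_hd N r0 (d0 : 'I_r0 -> int) r1 (d1 : 'I_r1 -> int) (A : 'M[R]_(r0, r1)) beta :
  minres N d0 d1 A beta -> minhom d0 d1 A /\ beta 0%N =1 dim d1.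
Proof. by case: N => [|N] /= [? ? ?]. Qed.

Lemma aug_mx_eq0 {r0 r1} (d0 : 'I_r0 -> int) (d1 : 'I_r1 -> int) A :
  minhom d0 d1 A -> map_mx (aug G) A = 0.
Proof. by case=> _ h; apply/matrixP => p q; rewrite !mxE h. Qed.

(** An entry of degree 0 is a constant, which the augmentation detects; negative degrees are
    empty. *)
Lemma minhom_le0 {r0 r1} (d0 : 'I_r0 -> int) (d1 : 'I_r1 -> int) A p q :
  minhom d0 d1 A -> d1 q - d0 p <= 0 -> A p q = 0.
Proof.
case=> h h0; rewrite le_eqVlt => /orP[/eqP e|lt0]; last by rewrite -h comp_lt0.
by rewrite -h e comp0_aug.
Qed.

Lemma hom1 {r} (d : 'I_r -> int) : hom d d 1%:M.
Proof.
move=> p q; rewrite mxE; case: eqVneq => [->|_]; last by rewrite raddf0.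
by rewrite subrr comp01.
Qed.

Lemma homM {r0 r1 r2} (d0 : 'I_r0 -> int) (d1 : 'I_r1 -> int) (d2 : 'I_r2 -> int) A B :
  hom d0 d1 A -> hom d1 d2 B -> hom d0 d2 (A *m B).
Proof.
move=> hA hB p q; rewrite mxE raddf_sum; apply: eq_bigr => l _ /=.
rewrite -{1}hA (_ : d2 q - d0 p = (d1 l - d0 p) + (d2 q - d1 l)); last by lia.
by rewrite compM hA hB.
Qed.

Lemma aug_hom {r0 r1} (d0 : 'I_r0 -> int) (d1 : 'I_r1 -> int) A p q :
  hom d0 d1 A -> d1 q != d0 p -> aug G (A p q) = 0.
Proof. by move=> h ne; rewrite -h aug_comp // subr_eq0. Qed.

(** Multiplication by the homogeneous [A] respects components, so cutting each entry of any lift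
    down to its expected degree gives a lift again. *)
Lemma hom_lift {r0 r1 r2} (d0 : 'I_r0 -> int) (d1 : 'I_r1 -> int) (d2 : 'I_r2 -> int)
    (A : 'M_(r0, r1)) (C : 'M_(r0, r2)) :
  hom d0 d1 A -> hom d0 d2 C -> im_le C A ->
  exists2 W, hom d1 d2 W & C = A *m W.
Proof.
move=> hA hC [W eW].
exists (\matrix_(p, q) comp G (d2 q - d1 p) (W p q)).
  by move=> p q; rewrite !mxE comp_id.
apply/matrixP => p q; rewrite -hC eW !mxE raddf_sum; apply: eq_bigr => l _ /=.
rewrite !mxE -{1}hA (_ : d2 q - d0 p = (d1 l - d0 p) + (d2 q - d1 l)); last by lia.
by rewrite compM hA.
Qed.

(** * Independence of Betti numbers from the minimal resolution *)

Lemma im_le_refl {r m} (A : 'M[R]_(r, m)) : im_le A A.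
Proof. by exists 1%:M; rewrite mulmx1. Qed.

Lemma im_le_trans {r m1 m2 m3} (A : 'M[R]_(r, m1)) (B : 'M[R]_(r, m2)) (C : 'M[R]_(r, m3)) :
  im_le A B -> im_le B C -> im_le A C.
Proof. by move=> [W ->] [W' ->]; exists (W' *m W); rewrite mulmxA. Qed.

(* Homogeneous matrices that are inverse modulo the irrelevant ideal are block
   diagonal there, with one block for each degree. *)
Lemma dim_le {r1 r2} (d1 : 'I_r1 -> int) (d2 : 'I_r2 -> int) (F : 'M[R]_(r2, r1))
    (H : 'M[R]_(r1, r2)) :
  hom d2 d1 F -> hom d1 d2 H ->
  map_mx (aug G) H *m map_mx (aug G) F = 1%:M -> forall j, (dim d1 j <= dim d2 j)%N.
Proof.
move=> hF hH e j.
pose A1 := [pred p | d1 p == j]; pose A2 := [pred p | d2 p == j].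
pose e1 (x : 'I_#|A1|) := enum_val x; pose e2 (x : 'I_#|A2|) := enum_val x.
apply: (@mulmx1_min k _ _ (mxsub e1 e2 (map_mx (aug G) H))
                          (mxsub e2 e1 (map_mx (aug G) F))).
apply/matrixP => x y; transitivity ((1%:M : 'M[k]_r1) (e1 x) (e1 y)); last first.
  by rewrite !mxE (inj_eq (@enum_val_inj _ _)).
rewrite -e !mxE (bigID A2) /= [X in _ + X]big1 ?addr0; last first.
  move=> p ne; rewrite !mxE (aug_hom hH) ?mul0r //.
  have := enum_valP x; rewrite inE => /eqP e1x.
  by move: ne; apply: contra => /eqP; rewrite /e1 e1x => ->.
rewrite [RHS](eq_bigl (fun p => p \in A2)) // [RHS]big_enum_val /=.
by apply: eq_bigr => p _; rewrite !mxE.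
Qed.

(** Here [f] and [g] start comparison maps in both directions; [s] and [t] start a homotopy from
    [g *m f] to the identity, [t] standing for the part through the preceding differential. Each
    step lifts all of them. At the end both differentials vanish modulo the irrelevant ideal, so
    [g1 *m f1] is the identity there. This uses the differential after index [N], hence [N.+1]. *)
Lemma minres_dim_le N : forall r0 (d0 : 'I_r0 -> int) r1 (d1 : 'I_r1 -> int) A beta
    r0' (d0' : 'I_r0' -> int) r1' (d1' : 'I_r1' -> int) A' beta' f g s t,
  minres N.+1 d0 d1 A beta -> minres N.+1 d0' d1' A' beta' ->
  hom d0' d0 f -> hom d0 d0' g ->
  im_le (f *m A) A' -> im_le (g *m A') A ->
  1%:M - g *m f = A *m s + t -> t *m A = 0 ->
  forall j, (beta N j <= beta' N j)%N.
Proof.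
elim: N => [|N IH] r0 d0 r1 d1 A beta r0' d0' r1' d1' A' beta' f g s t.
all: move=> [hA eb [r2 [d2 [B [AB exAB mB]]]]].
all: move=> [hA' eb' [r2' [d2' [B' [AB' exAB' mB']]]]] hf hg fA gA' est tA j.
all: have [f1 hf1 ef1] := hom_lift hA'.1 (homM hf hA.1) fA.
all: have [g1 hg1 eg1] := hom_lift hA.1 (homM hg hA'.1) gA'.
(* [A] kills this difference: the lifting equations and [t *m A = 0] turn [A - A *m g1 *m f1] into
   [A *m s *m A]. *)
all: have [s1 es1] : exists s1, 1%:M - g1 *m f1 - s *m A = B *m s1.
1,3: apply: exAB; rewrite !mulmxBr mulmx1 mulmxA -eg1 -mulmxA -ef1 !mulmxA.
1,2: have := congr1 (mulmx^~ A) est; rewrite mulmxBl mul1mx mulmxDl tA addr0.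
1,2: by rewrite -!mulmxA => ->; rewrite subrr.
all: have {}es1 : 1%:M - g1 *m f1 = B *m s1 + s *m A by rewrite -es1 subrK.
- rewrite eb eb'; apply: dim_le hf1 hg1 _ j.
  rewrite -map_mxM; have -> : g1 *m f1 = 1%:M - (B *m s1 + s *m A).
    by rewrite -es1 opprB addrC subrK.
  rewrite map_mxB map_mxD !map_mxM map_mx1 (aug_mx_eq0 hA).
  have [hB _ _] := mB.
  by rewrite (aug_mx_eq0 hB) mul0mx mulmx0 addr0 subr0.
(* The new [t] is [s *m A], which vanishes after multiplication by [B]. *)
- apply: (IH _ d1 _ d2 B (fun l => beta l.+1) _ d1' _ d2' B' (fun l => beta' l.+1)
    f1 g1 s1 (s *m A)) => //.
  + by apply: exAB'; rewrite mulmxA -ef1 -!mulmxA AB mulmx0.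
  + by apply: exAB; rewrite mulmxA -eg1 -!mulmxA AB' mulmx0.
  + by rewrite -mulmxA AB mulmx0.
Qed.

(** The images agree, so both comparison maps can begin with the identity and the zero homotopy. *)
Lemma minres_unique N r0 (d0 : 'I_r0 -> int) r1 (d1 : 'I_r1 -> int) A beta
    r1' (d1' : 'I_r1' -> int) A' beta' :
  minres N.+1 d0 d1 A beta -> minres N.+1 d0 d1' A' beta' ->
  im_le A A' -> im_le A' A -> beta N =1 beta' N.
Proof.
move=> m m' le le' j; apply/eqP; rewrite eqn_leq.
by apply/andP; split; apply: (@minres_dim_le N _ _ _ _ _ _ _ _ _ _ _ _
  1%:M 1%:M 0 0 _ _ (hom1 d0) (hom1 d0)); rewrite ?mul1mx ?subrr ?mulmx0 ?addr0 ?mul0mx //;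
  eassumption.
Qed.


Lemma minres_eq N : forall r0 (d0 : 'I_r0 -> int) r1 (d1 : 'I_r1 -> int) A beta beta',
  beta =2 beta' -> minres N d0 d1 A beta -> minres N d0 d1 A beta'.
Proof.
elim: N => [|N IH] r0 d0 r1 d1 A beta beta' e [hA eb H]; split => //.
1,2: by move=> j; rewrite -e.
have [r2 [d2 [B [? ? mB]]]] := H; exists r2, d2, B; split => //.
by apply: IH mB => l j.
Qed.

(** * Direct sums, twists and minimal block matrices *)

Lemma dim_dcat {r1 r2} (d1 : 'I_r1 -> int) (d2 : 'I_r2 -> int) j :
  dim (dcat d1 d2) j = (dim d1 j + dim d2 j)%N.
Proof.
rewrite /dim -!sum1_card big_split_ord /=.
congr (_ + _)%N; apply: eq_bigl => p; rewrite !inE /dcat.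
  by rewrite -[lshift _ _]/(unsplit (inl p)) unsplitK.
by rewrite -[rshift _ _]/(unsplit (inr p)) unsplitK.
Qed.

Lemma dim_dshift {r} (d : 'I_r -> int) c j : dim (dshift d c) j = dim d (j - c).
Proof. by apply: eq_card => p; rewrite !inE /dshift; lia. Qed.

Lemma minhom0 {r0 r1} (d0 : 'I_r0 -> int) (d1 : 'I_r1 -> int) : minhom d0 d1 0.
Proof. by split => p q; rewrite mxE raddf0. Qed.

Lemma minhomN {r0 r1} (d0 : 'I_r0 -> int) (d1 : 'I_r1 -> int) A :
  minhom d0 d1 A -> minhom d0 d1 (- A).
Proof. by case=> h h0; split => p q; rewrite mxE raddfN /= ?h ?h0 ?oppr0. Qed.

Lemma minhom_scalar {r} (d : 'I_r -> int) x :
  comp G 1 x = x -> minhom d (dshift d 1) x%:M.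
Proof.
move=> x1; split => p q; rewrite mxE; case: eqVneq => [e|_];
  rewrite ?mulr1n ?mulr0n ?raddf0 //.
  by rewrite e /dshift addrAC subrr add0r.
by rewrite -x1 aug_comp.
Qed.

Lemma minhom_row {r0 r1 r2} (d0 : 'I_r0 -> int) (d1 : 'I_r1 -> int) (d2 : 'I_r2 -> int) A B :
  minhom d0 d1 A -> minhom d0 d2 B -> minhom d0 (dcat d1 d2) (row_mx A B).
Proof.
move=> [hA hA0] [hB hB0]; split => p q; rewrite mxE /dcat.
  by case: (split q) => i; [apply: hA | apply: hB].
by case: (split q) => i.
Qed.

Lemma minhom_col {r0 r1 r2} (d0 : 'I_r0 -> int) (d1 : 'I_r1 -> int) (d2 : 'I_r2 -> int) A B :
  minhom d1 d0 A -> minhom d2 d0 B -> minhom (dcat d1 d2) d0 (col_mx A B).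
Proof.
move=> [hA hA0] [hB hB0]; split => p q; rewrite mxE /dcat.
  by case: (split p) => i; [apply: hA | apply: hB].
by case: (split p) => i.
Qed.

(* The entries of [h *m D] have degree at least 2, so their quotients by the
   linear form [x] have positive degree. *)
Lemma minhom_div {r0 r1 r2} (d0 : 'I_r0 -> int) (d1 : 'I_r1 -> int) (d2 : 'I_r2 -> int)
    x h D Z :
  comp G 1 x = x -> minhom d0 d1 h -> minhom d1 d2 D -> h *m D = x *: Z ->
  exists2 Z', minhom (dshift d0 1) d2 Z' & h *m D = x *: Z'.
Proof.
move=> x1 mh mD e.
(* Keeping only positive degrees makes the quotient minimal; in the other degrees the default 0 is
   correct because [h *m D] vanishes there. *)
exists (\matrix_(p, q) if 0 < d2 q - dshift d0 1 p then comp G (d2 q - dshift d0 1 p) (Z p q)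
                       else 0).
  split => p q; rewrite mxE; case: ifP => // lt0; rewrite ?comp_id ?raddf0 //.
  by rewrite aug_comp // gt_eqF.
apply/matrixP => p q; rewrite [RHS]mxE [X in _ = x * X]mxE; case: ifP => lt0.
  rewrite e [LHS]mxE; have := homM mh.1 mD.1 p q; rewrite e mxE -{1}x1.
  rewrite (_ : d2 q - d0 p = 1 + (d2 q - dshift d0 1 p)); last by rewrite /dshift; lia.
  by rewrite compM x1 => ->.
(* The total degree is at most 1, so in each summand one factor has degree at most 0 and is zero. *)
rewrite mulr0 mxE big1 // => l _.
have [le1|gt1] := lerP (d1 l - d0 p) 0; first by rewrite (minhom_le0 mh le1) mul0r.
rewrite (minhom_le0 mD) ?mulr0 //.
by move: lt0 gt1; rewrite /dshift; lia.
Qed.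

(** * Exact zero divisors, mapping cones and change of rings *)

Definition annihilator x y := forall z : R, x * z = 0 <-> exists u, z = y * u.

Lemma annihilator_mx x y {r m} (Z : 'M[R]_(r, m)) :
  annihilator x y -> x *: Z = 0 -> exists U, Z = y *: U.
Proof.
move=> ann xZ.
have /fin_all_exists[U eU] (pq : 'I_r * 'I_m) : exists u, Z pq.1 pq.2 = y * u.
  by apply/ann; have /matrixP/(_ pq.1 pq.2) := xZ; rewrite !mxE.
by exists (\matrix_(p, q) U (p, q)); apply/matrixP => p q; rewrite !mxE (eU (p, q)).
Qed.

Lemma annihilator_mul x y : annihilator x y -> x * y = 0.
Proof. by move=> ann; apply/ann; exists 1; rewrite mulr1. Qed.

(* A tail of the mapping cone of a comparison map from a minimal complex to the
   resolution of a free [R/x]-module with differentials [x], [y], [x], ... *)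
Lemma minres_cone N : forall x y, comp G 1 x = x -> comp G 1 y = y ->
  annihilator x y -> annihilator y x ->
  forall r0 (d0 : 'I_r0 -> int) r1 (d1 : 'I_r1 -> int) D r (d : 'I_r -> int) h beta,
  minres N d0 d1 D beta -> minhom d d1 h ->
  (forall m (V : 'M_(r1, m)), D *m V = 0 -> y *: (h *m V) = 0) ->
  minres N (dcat d0 d) (dcat d1 (dshift d 1)) (block_mx D 0 h x%:M)
    (fun l j => beta l j + dim d (j - l%:Z - 1))%N.
Proof.
elim: N => [|N IH] x y x1 y1 annx anny r0 d0 r1 d1 D r d h beta [hD eb H] hh yh.
all: split.
1,4: by apply: minhom_col; apply: minhom_row => //;
  [exact: minhom0 | exact: minhom_scalar].
1,3: by move=> j; rewrite dim_dcat dim_dshift eb subr0.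
  by [].
have [r2 [d2 [B [DB exDB mB]]]] := H.
have [hB _] := minres_hd mB.
(* [y] kills [h *m B], so [x] divides it; the quotient continues the comparison map. *)
have [Z0 eZ0] := annihilator_mx anny (yh _ _ DB).
have [Z hZ eZ] := minhom_div x1 hh hB eZ0.
(* The sign makes the lower left block of the product [h *m B - x *: Z], and [x] and [y] exchange
   roles. *)
exists (r2 + r)%N, (dcat d2 (dshift (dshift d 1) 1)), (block_mx B 0 (- Z) y%:M); split.
- rewrite mulmx_block DB !mul0mx !mulmx0 mulmxN !mul_scalar_mx eZ !addr0 addrN add0r.
  by rewrite scale_scalar_mx (annihilator_mul annx) -[RHS]block_mx0 raddf0.
- move=> m V; rewrite -[V]vsubmxK mul_block_col mul0mx addr0 -[0](@vsubmxK _ r0 r) !linear0.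
  (* Once the upper part is [B *m u], the lower equation says that [x] kills [Z *m u] plus the lower
     part; this sum is thus a multiple of [y]. *)
  case/eq_col_mx => /exDB[u eu]; rewrite eu mulmxA eZ mul_scalar_mx -scalemxAl -scalerDr.
  case/(annihilator_mx annx) => w ew; exists (col_mx u w).
  rewrite mul_block_col mul0mx addr0 mul_scalar_mx -ew mulNmx addrA addNr add0r.
  by [].
- apply: (minres_eq (beta := fun l j =>
    (beta l.+1 j + dim (dshift d 1) (j - l%:Z - 1))%N)) => [l j|].
    by rewrite dim_dshift; congr (_ + dim _ _)%N; lia.
  apply: (IH y x _ _ _ _ _ _ _ _ _ _ (dshift d 1)) => //; first exact: minhomN.
  by move=> m V BV; rewrite mulNmx scalerN scalemxAl -eZ -mulmxA BV mulmx0 oppr0.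
Qed.

(* [minres] over the quotient ring [R/a], with matrices lifted to [R]. *)
Fixpoint minres_mod (a : R) N r0 (d0 : 'I_r0 -> int) r1 (d1 : 'I_r1 -> int)
    (A : 'M[R]_(r0, r1)) (beta : nat -> int -> nat) : Prop :=
  [/\ minhom d0 d1 A, beta 0%N =1 dim d1 &
      if N is N'.+1 then
        exists r2 (d2 : 'I_r2 -> int) (B : 'M[R]_(r1, r2)),
          [/\ exists X, A *m B = a *: X,
              forall m (V : 'M_(r1, m)) X, A *m V = a *: X -> im_le V (row_mx B a%:M) &
              minres_mod a N' d1 d2 B (fun l => beta l.+1)]
      else True].

(** By induction the first syzygy, presented modulo [a] by [B], has a resolution over [R] starting
    with some [C] whose image is that of [row_mx B a%:M]. Then [a] divides [A *m C], and the
    quotient is the comparison map to which [minres_cone] applies. The index of [beta] is moved by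
    one so that [beta 0] counts the generators. *)
Lemma minres_of_mod (a b : R) N : comp G 1 a = a -> comp G 1 b = b ->
  annihilator a b -> annihilator b a ->
  forall r0 (d0 : 'I_r0 -> int) r1 (d1 : 'I_r1 -> int) A beta,
  minres_mod a N d0 d1 A (fun l => beta l.+1) -> beta 0%N =1 dim d0 ->
  exists r2 (d2 : 'I_r2 -> int) (C : 'M[R]_(r0, r2)),
    [/\ im_le C (row_mx A a%:M), im_le (row_mx A a%:M) C &
        minres N d0 d2 C (fun i j => \sum_(l < i.+2) beta (i.+1 - l)%N (j - l%:Z)%R)%N].
Proof.
move=> a1 b1 anna annb; elim: N => [|N IH] r0 d0 r1 d1 A beta [hA eb1 H] eb0.
all: exists (r1 + r0)%N, (dcat d1 (dshift d0 1)), (row_mx A a%:M); split;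
  try exact: im_le_refl.
all: split; first by [apply: minhom_row => //; apply: minhom_scalar].
1,3: by move=> j; rewrite dim_dcat dim_dshift big_ord_recr big_ord1 /= subr0 eb1 eb0.
  by [].
have [r2 [d2 [B [[X AB] exAB mB]]]] := H.
have [rC [dC [C [[W eC] [W' eC'] mC]]]] := IH _ d1 _ d2 B (fun l => beta l.+1) mB eb1.
have [hC _] := minres_hd mC.
have [Z0 eZ0] : exists Z, A *m C = a *: Z.
  rewrite eC -[W]vsubmxK mul_row_col mulmxDr mulmxA AB mul_scalar_mx.
  by rewrite -scalemxAl -scalemxAr -scalerDr; eexists.
have [Z hZ eZ] := minhom_div a1 hA hC eZ0.
exists (rC + r0)%N, (dcat dC (dshift (dshift d0 1) 1)), (block_mx C 0 (- Z) b%:M); split.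
- rewrite mul_row_block eZ mulmx0 mul_scalar_mx scalerN addrN add0r mul_scalar_mx.
  by rewrite scale_scalar_mx (annihilator_mul anna) raddf0 row_mx0.
(* The upper part of a kernel element is a syzygy modulo [a], so it lies in the image of [C]; what
   remains is killed by [a], hence divisible by [b]. *)
- move=> m V; rewrite -[V]vsubmxK mul_row_col mul_scalar_mx => e.
  have [|W1 eu] := exAB _ (usubmx V) (- dsubmx V).
    by apply/eqP; rewrite scalerN -subr_eq0 opprK e.
  move: e; rewrite eu eC' -mulmxA mulmxA eZ -scalemxAl -scalerDr.
  case/(annihilator_mx anna) => w ew; exists (col_mx (W' *m W1) w).
  by rewrite mul_block_col mul0mx addr0 mul_scalar_mx -ew mulNmx addrA addNr add0r.
(* The first matrix used [a], so the cone starts with [b]. *)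
- apply: (minres_eq _ (@minres_cone N b a b1 a1 annb anna _ _ _ _ _ _ (dshift d0 1) (- Z)
    _ mC (minhomN hZ) _)).
    (* The last summand counts the twisted copy of [F_0]; the others come from the induction. *)
    move=> l j; rewrite [RHS]big_ord_recr /= subnn eb0 dim_dshift.
    congr addn; last by congr dim; lia.
    by apply: eq_bigr => i _; congr beta; have := ltn_ord i; lia.
  by move=> m V CV; rewrite mulNmx scalerN scalemxAl -eZ -mulmxA CV mulmx0 oppr0.
Qed.

End Graded.

(** * Homogeneous components of polynomials *)

Section PolyComponents.

Context {k : fieldType} {n : nat}.
Implicit Types p q : {mpoly k[n]}.

(** Degrees are integers because differences of generator degrees may be negative. *)
Definition poly_comp (e : int) p : {mpoly k[n]} :=
  match e with Posz d => pihomog mdeg d p | Negz _ => 0 end.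

Lemma poly_comp_is_zmod_morphism e : zmod_morphism (poly_comp e).
Proof. by case: e => d p q /=; rewrite ?raddfB ?subr0. Qed.

HB.instance Definition _ e :=
  GRing.isZmodMorphism.Build _ _ (poly_comp e) (poly_comp_is_zmod_morphism e).

Lemma poly_comp_homog e d p :
  p \is d.-homog -> poly_comp e p = if e == d%:Z then p else 0.
Proof.
move=> hp; case: e => d' //=; rewrite eqz_nat eq_sym.
by case: eqVneq => [<-|ne]; [apply: pihomog_dE | apply: pihomog_ne0 hp].
Qed.

(** Both sides are additive in [q], which reduces to homogeneous [q]. *)
Lemma poly_comp_mul (d : nat) (f : int) p q :
  p \is d.-homog -> poly_comp (d%:Z + f) (p * q) = p * poly_comp f q.
Proof.
move=> hp; rewrite {1 2}(pihomog_partitionE (leqnn (mmeasure mdeg q))).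
rewrite mulr_sumr !raddf_sum mulr_sumr; apply: eq_bigr => i _ /=.
have hi := pihomogP mdeg i q.
rewrite (poly_comp_homog _ (dhomogM hp hi)) (poly_comp_homog _ hi) PoszD.
by rewrite (inj_eq (addrI _)); case: eqP => _; rewrite ?mulr0.
Qed.

Lemma poly_compM e f p q :
  poly_comp (e + f) (poly_comp e p * q) = poly_comp e p * poly_comp f q.
Proof.
by case: e => d /=; [apply/poly_comp_mul/pihomogP | rewrite !mul0r raddf0].
Qed.

Lemma poly_comp_id e p : poly_comp e (poly_comp e p) = poly_comp e p.
Proof. by case: e => d //=; rewrite pihomog_id. Qed.

Lemma poly_comp0 p : poly_comp 0 p = (p@_0%MM)%:MP.
Proof.
rewrite /= pihomogE (eq_bigl (pred1 0%MM)); last by move=> m; rewrite mdeg_eq0.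
have [h|h] := boolP (0%MM \in msupp p).
  rewrite -big_filter filter_pred1_uniq ?msupp_uniq // big_seq1.
  by rewrite mpolyX0 alg_mpolyC.
rewrite big_seq_cond big1 ?(memN_msupp_eq0 h) ?mpolyC0 //.
by move=> m /andP[hm /eqP e]; rewrite -e hm in h.
Qed.

Lemma mcoeff0_homog d p : p \is d.-homog -> d != 0%N -> p@_0%MM = 0.
Proof. by move=> /dhomog_nemf_coeff h d0; apply: h; rewrite mf0 eq_sym. Qed.

Lemma mcoeff0_poly_comp e p : e != 0 -> (poly_comp e p)@_0%MM = 0.
Proof.
case: e => [d|d] d0; last by rewrite mcoeff0.
exact: mcoeff0_homog (pihomogP mdeg d p) _.
Qed.

End PolyComponents.

(** * The quotient by a proper homogeneous ideal as a graded ring *)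

Section Ideal.

Context {k : fieldType} {n : nat} (gs : seq {mpoly k[n]}).
Implicit Types f g : {mpoly k[n]}.

Lemma in_ideal0 : in_ideal gs 0.
Proof. by exists (fun=> 0); rewrite big1 // => i _; rewrite mul0r. Qed.

Lemma in_idealD f g : in_ideal gs f -> in_ideal gs g -> in_ideal gs (f + g).
Proof.
move=> [c ->] [c' ->]; exists (fun i => c i + c' i).
by rewrite -big_split; apply: eq_bigr => i _; rewrite mulrDl.
Qed.

Lemma in_idealMl f g : in_ideal gs g -> in_ideal gs (f * g).
Proof.
move=> [c ->]; exists (fun i => f * c i).
by rewrite mulr_sumr; apply: eq_bigr => i _; rewrite mulrA.
Qed.

Lemma in_ideal_sum m (F : 'I_m -> {mpoly k[n]}) :
  (forall i, in_ideal gs (F i)) -> in_ideal gs (\sum_i F i).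
Proof. by move=> h; apply: big_ind => //; [exact: in_ideal0 | exact: in_idealD]. Qed.

Lemma in_ideal_mem g : g \in gs -> in_ideal gs g.
Proof.
move=> hg; have lt := hg; rewrite -index_mem in lt.
exists (fun i => (i == Ordinal lt)%:R).
rewrite (bigD1 (Ordinal lt)) //= eqxx mul1r nth_index // big1 ?addr0 //.
by move=> i /negbTE ->; rewrite mul0r.
Qed.

Lemma in_ideal_cons a f :
  in_ideal (a :: gs) f <-> exists u, in_ideal gs (f - a * u).
Proof.
split=> [[c ->]|[u [c e]]].
  exists (c ord0), (fun i => c (lift ord0 i)).
  by rewrite big_ord_recl /= mulrC addrAC subrr add0r.
exists (fun i : 'I_(size gs).+1 => if unlift ord0 i is Some j then c j else u).
rewrite big_ord_recl unlift_none /= mulrC.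
under eq_bigr do rewrite liftK.
by rewrite -e addrC subrK.
Qed.

Hypothesis gs_homog : forall g, g \in gs -> exists e : nat, g \is e.-homog.
Hypothesis gs_proper : ~ in_ideal gs 1.

(** For a generator of degree [d], the component of degree [e] of a multiple is the component of
    degree [e - d] of the coefficient times the generator. *)
Lemma in_ideal_comp e f : in_ideal gs f -> in_ideal gs (poly_comp e f).
Proof.
move=> [c ->]; rewrite raddf_sum; apply: in_ideal_sum => i /=.
have hi : gs`_i \in gs by rewrite mem_nth.
have [d hd] := gs_homog hi.
rewrite mulrC (_ : e = d%:Z + (e - d%:Z)); last by rewrite addrC subrK.
by rewrite (poly_comp_mul _ _ hd) mulrC; apply/in_idealMl/in_ideal_mem.
Qed.

(** The constant term is the component of degree 0, and a nonzero constant in the ideal would be a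
    unit. *)
Lemma in_ideal_mcoeff0 f : in_ideal gs f -> f@_0%MM = 0.
Proof.
move=> /(in_ideal_comp 0); rewrite poly_comp0 => h.
apply/eqP; apply/negPn/negP => f0; apply: gs_proper.
have := in_idealMl (f@_0%MM)^-1%:MP h.
by rewrite -mpolyCM mulVf.
Qed.

(** Quotient types need a boolean predicate, hence excluded middle. Carrying the proof of properness
    lets the ideal structure be attached to the predicate. *)
Definition ideal_mem (_ : ~ in_ideal gs 1) f : bool :=
  if excluded_middle_informative (in_ideal gs f) then true else false.

Lemma ideal_memP f : reflect (in_ideal gs f) (ideal_mem gs_proper f).
Proof. by rewrite /ideal_mem; case: excluded_middle_informative => h; constructor. Qed.

Lemma ideal_mem_closed : idealr_closed (ideal_mem gs_proper).
Proof.
split; first exact/ideal_memP/in_ideal0.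
  exact/ideal_memP.
move=> f u v /ideal_memP hu /ideal_memP hv.
exact/ideal_memP/in_idealD/hv/in_idealMl/hu.
Qed.

HB.instance Definition _ := isIdealr.Build _ (ideal_mem gs_proper) ideal_mem_closed.

Definition quot_ideal : idealr {mpoly k[n]} := ideal_mem gs_proper.

Definition quot_ring : comNzRingType := {ideal_quot quot_ideal}.

Definition quot_proj : {rmorphism {mpoly k[n]} -> quot_ring} :=
  \pi_({ideal_quot quot_ideal})%qT.

Lemma quot_proj_eq f g : quot_proj f = quot_proj g <-> in_ideal gs (f - g).
Proof.
split=> [/eqP h|h]; first by apply/ideal_memP; move: h; rewrite -Quotient.idealrBE.
by apply/eqP; rewrite -Quotient.idealrBE; apply/ideal_memP.
Qed.

Lemma quot_proj_repr (x : quot_ring) : quot_proj (repr x) = x.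
Proof. exact: (@reprK _ {ideal_quot quot_ideal}). Qed.

Lemma quot_proj_surj (x : quot_ring) : exists f, x = quot_proj f.
Proof. by exists (repr x); rewrite quot_proj_repr. Qed.

Definition quot_comp e (x : quot_ring) : quot_ring := quot_proj (poly_comp e (repr x)).

(** Independence of the representative: a homogeneous ideal contains the components of its
    elements. *)
Lemma quot_compE e f : quot_comp e (quot_proj f) = quot_proj (poly_comp e f).
Proof.
apply/quot_proj_eq; rewrite -raddfB; apply: in_ideal_comp.
by apply/quot_proj_eq; rewrite quot_proj_repr.
Qed.

Lemma quot_comp_is_zmod_morphism e : zmod_morphism (quot_comp e).
Proof.
move=> x y; have [f ->] := quot_proj_surj x; have [g ->] := quot_proj_surj y.
by rewrite -rmorphB !quot_compE -rmorphB raddfB.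
Qed.

HB.instance Definition _ e :=
  GRing.isZmodMorphism.Build _ _ (quot_comp e) (quot_comp_is_zmod_morphism e).

Definition quot_aug (x : quot_ring) : k := (repr x)@_0%MM.

Lemma quot_augE f : quot_aug (quot_proj f) = f@_0%MM.
Proof.
apply/eqP; rewrite -subr_eq0 -mcoeffB; apply/eqP/in_ideal_mcoeff0.
by apply/quot_proj_eq; rewrite quot_proj_repr.
Qed.

Lemma quot_aug_is_zmod_morphism : zmod_morphism quot_aug.
Proof.
move=> x y; have [f ->] := quot_proj_surj x; have [g ->] := quot_proj_surj y.
by rewrite -rmorphB !quot_augE mcoeffB.
Qed.

Lemma quot_aug_is_monoid_morphism : monoid_morphism quot_aug.
Proof.
split=> [|x y]; first by rewrite -(rmorph1 quot_proj) quot_augE rmorph1.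
have [f ->] := quot_proj_surj x; have [g ->] := quot_proj_surj y.
by rewrite -rmorphM !quot_augE rmorphM.
Qed.

HB.instance Definition _ :=
  GRing.isZmodMorphism.Build _ _ quot_aug quot_aug_is_zmod_morphism.
HB.instance Definition _ :=
  GRing.isMonoidMorphism.Build _ _ quot_aug quot_aug_is_monoid_morphism.

Lemma quot_comp_id e x : quot_comp e (quot_comp e x) = quot_comp e x.
Proof. by have [f ->] := quot_proj_surj x; rewrite !quot_compE poly_comp_id. Qed.

Lemma quot_compM e d x y :
  quot_comp (e + d) (quot_comp e x * y) = quot_comp e x * quot_comp d y.
Proof.
have [f ->] := quot_proj_surj x; have [g ->] := quot_proj_surj y.
by rewrite !quot_compE -!rmorphM !quot_compE poly_compM.
Qed.

Lemma quot_comp01 : quot_comp 0 1 = 1.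
Proof.
by rewrite -(rmorph1 quot_proj) quot_compE poly_comp0 mcoeff1 eqxx mpolyC1.
Qed.

Lemma quot_comp_lt0 e x : e < 0 -> quot_comp e x = 0.
Proof. by case: e => // d _; rewrite /quot_comp /= rmorph0. Qed.

Lemma quot_comp0_aug x : quot_aug x = 0 -> quot_comp 0 x = 0.
Proof.
have [f ->] := quot_proj_surj x.
by rewrite quot_augE quot_compE poly_comp0 => ->; rewrite mpolyC0 rmorph0.
Qed.

Lemma quot_aug_comp e x : e != 0 -> quot_aug (quot_comp e x) = 0.
Proof.
by have [f ->] := quot_proj_surj x; rewrite quot_compE quot_augE; apply: mcoeff0_poly_comp.
Qed.

Definition quot_grading : grading k quot_ring :=
  @Grading k quot_ring quot_comp quot_aug quot_comp_id quot_compM quot_comp01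
    quot_comp_lt0 quot_comp0_aug quot_aug_comp.

End Ideal.

(** * From polynomial representatives to matrices over the quotient ring *)

Lemma im_le_col {R : comNzRingType} {r m1 m2} (V : 'M[R]_(r, m1)) (A : 'M[R]_(r, m2)) :
  (forall q, im_le (col q V) A) -> im_le V A.
Proof.
move=> /fin_all_exists[W eW]; exists (\matrix_(p, q) W q p 0).
apply/matrixP => p q; have /matrixP/(_ p 0) := eW q; rewrite !mxE => ->.
by apply: eq_bigr => l _; rewrite mxE.
Qed.

Lemma minres_castmx {k : fieldType} {R : comNzRingType} (G : grading k R) N r0 r0'
    (e : r0 = r0') (d0 : 'I_r0 -> int) (d0' : 'I_r0' -> int) r1 (d1 : 'I_r1 -> int) A beta :
  (forall p, d0' (cast_ord e p) = d0 p) ->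
  minres G N d0 d1 A beta -> minres G N d0' d1 (castmx (e, erefl) A) beta.
Proof.
case: _ / e d0' => d0' ed; rewrite castmx_id.
have {}ed p : d0' p = d0 p by rewrite -ed cast_ord_id.
by case: N => [|N] [[hA hA0] eb H]; split=> //; split=> // p q; rewrite ed.
Qed.

Lemma dim_seq (s : seq int) j : dim (fun p : 'I_(size s) => s`_p) j = count (pred1 j) s.
Proof. by rewrite /dim -sum1_card -sum1_count (big_nth 0) big_mkord. Qed.

Section Transfer.

Context {k : fieldType} {n : nat} (gs : seq {mpoly k[n]}).
Hypothesis gs_homog : forall g, g \in gs -> exists e : nat, g \is e.-homog.
Hypothesis gs_proper : ~ in_ideal gs 1.

Local Notation pi := (quot_proj gs_proper).
Local Notation G := (quot_grading gs_homog gs_proper).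
Local Notation deg s := (fun p : 'I_(size s) => s`_p).

Lemma quot_proj_eq0 f : pi f = 0 <-> in_ideal gs f.
Proof. by have := quot_proj_eq gs_proper f 0; rewrite rmorph0 subr0. Qed.

Lemma in_ideal_consE a f : in_ideal (a :: gs) f <-> exists u, pi f = pi a * u.
Proof.
split=> [/in_ideal_cons[u /(quot_proj_eq gs_proper)]|[x]].
  by rewrite rmorphM => e; exists (pi u).
have [u ->] := quot_proj_surj x; rewrite -rmorphM => /quot_proj_eq h.
by apply/in_ideal_cons; exists u.
Qed.

Lemma map_quot_proj_surj {r m} (V : 'M[quot_ring gs_proper]_(r, m)) :
  exists V', V = map_mx pi V'.
Proof.
exists (map_mx repr V); apply/matrixP => p q.
by rewrite !mxE quot_proj_repr.
Qed.

Lemma in_imageE {r m} (A : 'M_(r, m)) v :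
  in_image gs A v <-> im_le (map_mx pi v) (map_mx pi A).
Proof.
split=> [[w h]|[w]].
  exists (map_mx pi w); rewrite -map_mxM; apply/matrixP => p q; rewrite ord1.
  by have := h p; rewrite !mxE; move/(quot_proj_eq gs_proper).
have [w' ->] := map_quot_proj_surj w; rewrite -map_mxM => /matrixP e.
by exists w' => p; have := e p 0; rewrite !mxE => /quot_proj_eq.
Qed.

(** Working modulo [a] amounts to adjoining the columns of [a] times the identity. *)
Lemma in_image_consE a {r m} (A : 'M_(r, m)) v :
  in_image (a :: gs) A v <-> im_le (map_mx pi v) (row_mx (map_mx pi A) (pi a)%:M).
Proof.
split=> [[w]|[w]].
  move=> h; have /fin_all_exists[u eu] p : exists u, pi ((v - A *m w) p 0) = pi a * u.
    exact/in_ideal_consE.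
  exists (col_mx (map_mx pi w) (\col_p u p)).
  rewrite mul_row_col mul_scalar_mx -map_mxM; apply/matrixP => p q; rewrite ord1.
  have := eu p; rewrite !mxE rmorphB => /eqP; rewrite subr_eq => /eqP ->.
  by rewrite addrC.
rewrite -[w]vsubmxK mul_row_col mul_scalar_mx.
have [w' ->] := map_quot_proj_surj (usubmx w); rewrite -map_mxM => /matrixP e.
exists w' => p; apply/in_ideal_consE; exists (dsubmx w p 0).
have := e p 0; rewrite !mxE rmorphB => ->.
by rewrite addrAC subrr add0r.
Qed.

Lemma minhom_quot (s0 s1 : seq int) (A : 'M_(size s0, size s1)) :
  (forall (p : 'I_(size s0)) (q : 'I_(size s1)), let e := s1`_q - s0`_p in
    (e < 0 -> A p q = 0) /\ (0 <= e -> A p q \is (`|e|%N).-homog)) ->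
  (forall p q, (A p q)@_0%MM = 0) ->
  minhom G (deg s0) (deg s1) (map_mx pi A).
Proof.
move=> hA A0; split=> p q; rewrite mxE /=; last by rewrite quot_augE.
rewrite quot_compE //; congr (pi _); have [/= lt0 ge0] := hA p q.
have [ge|/lt0 ->] := lerP 0 (s1`_q - s0`_p); last by rewrite raddf0.
by rewrite (poly_comp_homog _ (ge0 ge)) gez0_abs // eqxx.
Qed.

Lemma is_min_graded_res_shift hs d phi :
  is_min_graded_res hs d phi ->
  @is_min_graded_res k n hs (fun i => d i.+1) (fun i => phi i.+1).
Proof. by case=> h1 h2 h3 h4; split=> i; [apply: h1 | apply: h2 | apply: h3 | apply: h4]. Qed.

(** The index is moved by one because [minres] counts sources of matrices, so [F_0] is left out. *)
Lemma minres_quot N : forall d phi, is_min_graded_res gs d phi ->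
  minres G N (deg (d 0%N)) (deg (d 1%N)) (map_mx pi (phi 0%N)) (fun i => betti d i.+1).
Proof.
elim: N => [|N IH] d phi res; have [hphi phi0 phiphi exphi] := res.
all: have h := minhom_quot (hphi 0%N) (phi0 0%N); split => //; first by
  move=> j; rewrite dim_seq.
exists _, (deg (d 2%N)), (map_mx pi (phi 1%N)); split.
- rewrite -map_mxM; apply/matrixP => p q; rewrite [LHS]mxE [RHS]mxE.
  exact/quot_proj_eq0.
- move=> m V; have [V' ->] := map_quot_proj_surj V.
  rewrite -map_mxM => /matrixP e; apply: im_le_col => q; rewrite -map_col.
  apply/in_imageE/exphi => p; apply/quot_proj_eq0.
  by rewrite colE mulmxA -colE; have := e p q; rewrite !mxE.
- exact: IH (is_min_graded_res_shift res).
Qed.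

Lemma minres_mod_quot a N : forall d phi, is_min_graded_res (a :: gs) d phi ->
  minres_mod G (pi a) N (deg (d 0%N)) (deg (d 1%N)) (map_mx pi (phi 0%N))
    (fun i => betti d i.+1).
Proof.
elim: N => [|N IH] d phi res; have [hphi phi0 phiphi exphi] := res.
all: have h := minhom_quot (hphi 0%N) (phi0 0%N); split => //; first by
  move=> j; rewrite dim_seq.
exists _, (deg (d 2%N)), (map_mx pi (phi 1%N)); split.
- have /fin_all_exists[X eX] (pq : 'I_(size (d 0%N)) * 'I_(size (d 2%N))) :
      exists u, pi ((phi 0%N *m phi 1%N) pq.1 pq.2) = pi a * u.
    exact/in_ideal_consE.
  exists (\matrix_(p, q) X (p, q)); rewrite -map_mxM; apply/matrixP => p q.
  by rewrite [LHS]mxE (eX (p, q)) !mxE.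
- move=> m V X; have [V' ->] := map_quot_proj_surj V.
  rewrite -map_mxM => /matrixP e; apply: im_le_col => q; rewrite -map_col.
  apply/in_image_consE/exphi => p; apply/in_ideal_consE; exists (X p q).
  by rewrite colE mulmxA -colE; have := e p q; rewrite !mxE.
- exact: IH (is_min_graded_res_shift res).
Qed.

Lemma same_presentationE a {r m1 m2} (A : 'M_(r, m1)) (B : 'M_(r, m2)) :
  same_presentation gs a A B ->
  im_le (map_mx pi A) (row_mx (map_mx pi B) (pi a)%:M) /\
  im_le (row_mx (map_mx pi B) (pi a)%:M) (map_mx pi A).
Proof.
have e : row_mx (map_mx pi B) (pi a)%:M = map_mx pi (row_mx B a%:M).
  by rewrite map_row_mx map_scalar_mx.
by case=> h1 h2; rewrite e; split; apply: im_le_col => q; rewrite -map_col; apply/in_imageE.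
Qed.

Lemma annihilator_quot a b :
  (forall f, in_ideal gs (f * a) <-> in_ideal (b :: gs) f) ->
  annihilator (pi a) (pi b).
Proof.
move=> ab x; have [f ->] := quot_proj_surj x.
rewrite -rmorphM mulrC; split=> [/quot_proj_eq0/ab/in_ideal_consE //|h].
exact/quot_proj_eq0/ab/in_ideal_consE.
Qed.

Lemma comp1_quot a : a \is 1%N.-homog -> comp G 1 (pi a) = pi a.
Proof. by move=> ha; rewrite /= quot_compE // (poly_comp_homog _ ha). Qed.

End Transfer.

(** * Comparison of the given resolution with the constructed cone *)

Theorem theorem1p10 (k : fieldType) (n : nat) (gs : seq {mpoly k[n]})
  (a b : {mpoly k[n]})
  (dR : nat -> seq int) (phiR : forall i, 'M[{mpoly k[n]}]_(size (dR i), size (dR i.+1)))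
  (dS : nat -> seq int) (phiS : forall i, 'M[{mpoly k[n]}]_(size (dS i), size (dS i.+1)))
  (e0 : size (dR 0%N) = size (dS 0%N)) :
  (forall g, g \in gs -> exists e : nat, g \is e.-homog) ->
  a \is 1%N.-homog -> b \is 1%N.-homog ->
  exact_zero_divisor_pair gs a b ->
  is_min_graded_res (a :: gs) dS phiS ->
  (forall x, x \in dS 0%N -> 0 <= x) ->
  is_min_graded_res gs dR phiR ->
  dR 0%N = dS 0%N ->
  same_presentation gs a (castmx (e0, erefl) (phiR 0%N)) (phiS 0%N) ->
  forall (i : nat) (j : int),
    betti dR i j = (\sum_(l < i.+1) betti dS (i - l)%N (j - (l : nat)%:Z))%N.
Proof.
move=> gs_homog a1 b1 [[na _] [_ [ab ba]]] resS _ resR e00 pres [|i] j.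
  by rewrite big_ord1 subn0 subr0 /betti e00.
have gs_proper : ~ in_ideal gs 1.
  by move=> h; apply: na; rewrite -[a]mulr1; apply: in_idealMl.
have [leR geR] := same_presentationE gs_proper pres.
(* The length is [i.+1] because uniqueness at index [i] looks one matrix further. *)
have resS' := minres_mod_quot gs_homog gs_proper i.+1 resS.
have [r2 [d2 [C [leC geC resC]]]] := minres_of_mod
  (comp1_quot gs_homog gs_proper a1) (comp1_quot gs_homog gs_proper b1)
  (annihilator_quot ab) (annihilator_quot ba) resS'
  (fun j => esym (dim_seq (dS 0%N) j)).
(* The sizes of [dR 0] and [dS 0] are only propositionally equal, so a cast puts both resolutions
   over one [F_0]. *)
have resR' : minres (quot_grading gs_homog gs_proper) i.+1
    (fun p : 'I_(size (dS 0%N)) => (dS 0%N)`_p) (fun p : 'I_(size (dR 1%N)) => (dR 1%N)`_p)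
    (castmx (e0, erefl) (map_mx (quot_proj gs_proper) (phiR 0%N)))
    (fun i => betti dR i.+1).
  apply: minres_castmx (minres_quot gs_homog gs_proper i.+1 resR) => p.
  exact: (congr1 (fun s : seq int => s`_p) (esym e00)).
rewrite map_castmx in leR geR.
exact: minres_unique resR' resC (im_le_trans leR geC) (im_le_trans leC geR) j.
Qed.
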